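(* If $\tau\in\{1001,1011,1101\}$, then $$f_\tau(x)=\frac{1-3x+3x^2-\sqrt{(1-3x+x^2)^2-4x^3(1-x)}}{2x^2}$$ as formal power series in $x$, where $f_\tau(x)=\sum_{n\ge 0} b_n(\tau)x^n$ and $b_n(\tau)$ is the number of ascent sequences of length $n$ that avoid both patterns $021$ and $\tau$.
   Context: For a finite sequence $w=w_1\cdots w_n$ of integers, $\mathrm{asc}(w)$ is the number of indices $1\le i\le n-1$ with $w_i<w_{i+1}$. An ascent sequence of length $n\ge 1$ is a sequence $a_1\cdots a_n$ of non-negative integers such that $a_1=0$ and $a_i\le \mathrm{asc}(a_1\cdots a_{i-1})+1$ for $1<i\le n$; there is exactly one (empty) ascent sequence of length $0$. A sequence $\pi=\pi_1\cdots\pi_n$ contains a pattern $\tau=\tau_1\cdots\tau_m$ if there are indices $1\le i_1<\cdots<i_m\le n$ such that for all $j,k\in\{1,\dots,m\}$: $\pi_{i_j}<\pi_{i_k}$ iff $\tau_j<\tau_k$, and $\pi_{i_j}=\pi_{i_k}$ iff $\tau_j=\tau_k$; otherwise $\pi$ avoids $\tau$. For a pattern $\tau$, $B_n(\tau)$ is the set of ascent sequences of length $n$ avoiding both $021$ and $\tau$ (with $B_0(\tau)$ consisting of the empty sequence), and $b_n(\tau)=|B_n(\tau)|$. The square root denotes the formal power series square root with constant term $1$. *)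

(* Defs.v *)
From HB Require Import structures.
From mathcomp Require Import all_boot all_order all_algebra.
From mathcomp Require Import boolp.

Set Implicit Arguments.
Unset Strict Implicit.
Unset Printing Implicit Defensive.

Import GRing.Theory.

(** * Ascent sequences and pattern avoidance
    Sequences are 0-indexed, so that [nth 0 w i] is the letter w_{i+1}. *)

Section AscentSequences.
Local Open Scope nat_scope.

Definition asc (w : seq nat) : nat :=
  \sum_(i < (size w).-1) (nth 0 w i < nth 0 w i.+1).

(** The empty sequence qualifies, since [nth 0 [::] 0 = 0]. *)
Definition ascent_seq (w : seq nat) : bool :=
  (nth 0 w 0 == 0) &&
  [forall i : 'I_(size w), (0 < i) ==> (nth 0 w i <= asc (take i w) + 1)].

Definition contains (w tau : seq nat) : bool :=
  [exists f : {ffun 'I_(size tau) -> 'I_(size w)},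
    [forall j : 'I_(size tau), forall k : 'I_(size tau), (j < k) ==> (f j < f k)] &&
    [forall j : 'I_(size tau), forall k : 'I_(size tau),
       ((nth 0 w (f j) < nth 0 w (f k)) == (nth 0 tau j < nth 0 tau k)) &&
       ((nth 0 w (f j) == nth 0 w (f k)) == (nth 0 tau j == nth 0 tau k))]].

Definition avoids (w tau : seq nat) : bool := ~~ contains w tau.

(** The letters of an ascent sequence of length n are smaller than n
    ([ascent_seq_bound]), hence the carrier ['I_n]; see [mem_B]. *)
Definition B (n : nat) (tau : seq nat) : {set n.-tuple 'I_n} :=
  [set t : n.-tuple 'I_n | let w := map val t in
     [&& ascent_seq w, avoids w [:: 0; 2; 1] & avoids w tau]].

Definition b (n : nat) (tau : seq nat) : nat := #|B n tau|.

Lemma asc_le w : asc w <= (size w).-1.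
Proof.
rewrite /asc -[leqRHS]card_ord -sum1_card.
by apply: leq_sum => i _; case: (_ < _).
Qed.

Lemma ascent_seq_bound w i : ascent_seq w -> i < size w -> nth 0 w i < size w.
Proof.
case/andP=> /eqP w0 /forallP hw ltiw.
case: (posnP i) => [i0 | i_gt0].
  by rewrite i0 w0; apply: leq_ltn_trans ltiw.
have /implyP/(_ i_gt0)/= hi := hw (Ordinal ltiw).
apply: (leq_ltn_trans hi); apply: leq_ltn_trans (ltiw).
rewrite addn1 -[leqRHS](prednK i_gt0) ltnS.
by rewrite (leq_trans (asc_le _)) // size_take ltiw.
Qed.

Lemma mem_B n tau w :
  (exists2 t, t \in B n tau & w = map val t) <->
  [/\ size w = n, ascent_seq w, avoids w [:: 0; 2; 1] & avoids w tau].
Proof.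
split=> [[t] | [szw aw a1 a2]].
  by rewrite inE => /and3P[? ? ?] ->; split; rewrite ?size_map ?size_tuple.
have lt_w x : x \in w -> x < n.
  by case/(nthP 0) => i ltiw <-; rewrite -szw; exact: ascent_seq_bound.
have mapK : map val (pmap (insub : nat -> option 'I_n) w) = w.
  rewrite pmap_filter; last by move=> x; case: insubP => //= u _ ->.
  by apply/all_filterP/allP => x /lt_w ltx; rewrite insubT.
have szt : size (pmap (insub : nat -> option 'I_n) w) == n.
  by rewrite -(size_map val) mapK szw.
by exists (Tuple szt); rewrite ?inE /= mapK ?aw ?a1.
Qed.

End AscentSequences.

(** * Formal power series over a field *)

Local Open Scope ring_scope.

Record fps (F : fieldType) := Fps { coeff :> nat -> F }.

Section FormalPowerSeries.
Variable F : fieldType.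
Implicit Types f g h : fps F.

Lemma fps_eqP f g : f =1 g -> f = g.
Proof. by case: f g => [f] [g] /= /funext ->. Qed.

HB.instance Definition _ := gen_eqMixin (fps F).
HB.instance Definition _ := gen_choiceMixin (fps F).

Definition fps_const (c : F) : fps F := Fps (fun n => if n == 0%N then c else 0).
Definition fpsX : fps F := Fps (fun n => (n == 1%N)%:R).
Definition fps_add f g : fps F := Fps (fun n => f n + g n).
Definition fps_opp f : fps F := Fps (fun n => - f n).
Definition fps_mul f g : fps F :=
  Fps (fun n => \sum_(i < n.+1) f i * g (n - i)%N).

Lemma fps_addA : associative fps_add.
Proof. by move=> f g h; apply: fps_eqP => n /=; rewrite addrA. Qed.
Lemma fps_addC : commutative fps_add.
Proof. by move=> f g; apply: fps_eqP => n /=; rewrite addrC. Qed.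
Lemma fps_add0 : left_id (fps_const 0) fps_add.
Proof. by move=> f; apply: fps_eqP => n /=; rewrite if_same add0r. Qed.
Lemma fps_addN : left_inverse (fps_const 0) fps_opp fps_add.
Proof. by move=> f; apply: fps_eqP => n /=; rewrite if_same addNr. Qed.

HB.instance Definition _ :=
  GRing.isZmodule.Build (fps F) fps_addA fps_addC fps_add0 fps_addN.

(** Truncation to polynomials transfers the ring laws. *)
Let T n f : {poly F} := \poly_(i < n.+1) f i.

Let coefT n f i : (i <= n)%N -> (T n f)`_i = f i.
Proof. by move=> lein; rewrite coef_poly ltnS lein. Qed.

Let mulE n f g (p q : {poly F}) :
    (forall i, (i <= n)%N -> p`_i = f i) ->
    (forall i, (i <= n)%N -> q`_i = g i) ->
  forall i, (i <= n)%N -> (p * q)`_i = fps_mul f g i.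
Proof.
move=> hp hq i lein; rewrite coefM; apply: eq_bigr => j _.
have leji : (j <= i)%N by rewrite -ltnS.
by rewrite hp ?hq //; apply: leq_trans lein; rewrite ?leq_subr.
Qed.

Lemma fps_mulC : commutative fps_mul.
Proof.
move=> f g; apply: fps_eqP => n.
by rewrite -!(mulE (@coefT n _) (@coefT n _) (leqnn n)) mulrC.
Qed.

Lemma fps_mulA : associative fps_mul.
Proof.
move=> f g h; apply: fps_eqP => n.
rewrite -(mulE (@coefT n f) (mulE (@coefT n g) (@coefT n h)) (leqnn n)).
by rewrite -(mulE (mulE (@coefT n f) (@coefT n g)) (@coefT n h) (leqnn n)) mulrA.
Qed.

Lemma fps_mul1 : left_id (fps_const 1) fps_mul.
Proof.
move=> f; apply: fps_eqP => n /=.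
by rewrite big_ord_recl /= mul1r subn0 big1 ?addr0 // => i _; rewrite mul0r.
Qed.

Lemma fps_mulDl : left_distributive fps_mul fps_add.
Proof.
move=> f g h; apply: fps_eqP => n /=; rewrite -big_split /=.
by apply: eq_bigr => i _; rewrite mulrDl.
Qed.

Lemma fps_oner_neq0 : fps_const 1 != 0.
Proof. by apply/eqP => /(congr1 (fun f : fps F => f 0%N))/eqP; rewrite oner_eq0. Qed.

HB.instance Definition _ := GRing.Zmodule_isComNzRing.Build (fps F)
  fps_mulA fps_mulC fps_mul1 fps_mulDl fps_oner_neq0.

Lemma coeff0 n : (0 : fps F) n = 0.
Proof. exact: if_same. Qed.
Lemma coeff1 n : (1 : fps F) n = (n == 0%N)%:R.
Proof. by rewrite /1 /=; case: (n == 0%N). Qed.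
Lemma coeffD f g n : (f + g) n = f n + g n.
Proof. by []. Qed.
Lemma coeffN f n : (- f) n = - f n.
Proof. by []. Qed.
Lemma coeffM f g n : (f * g) n = \sum_(i < n.+1) f i * g (n - i)%N.
Proof. by []. Qed.

Definition fps_unit : pred (fps F) := fun f => `[< exists g, g * f = 1 >].
Definition fps_inv f : fps F :=
  if pselect (exists g, g * f = 1) is left gf1 then projT1 (cid gf1) else f.

Lemma fps_mulVr : {in fps_unit, left_inverse 1 fps_inv *%R}.
Proof.
move=> f /asboolP uf; rewrite /fps_inv; case: pselect => [gf1|/(_ uf)//].
by case: (cid gf1).
Qed.
Lemma fps_unitPl f g : g * f = 1 -> fps_unit f.
Proof. by move=> gf1; apply/asboolP; exists g. Qed.
Lemma fps_invr_out : {in [predC fps_unit], fps_inv =1 id}.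
Proof.
move=> f /negP nuf; rewrite /fps_inv; case: pselect => // uf.
by case: nuf; apply/asboolP.
Qed.

HB.instance Definition _ := GRing.ComNzRing_hasMulInverse.Build (fps F)
  fps_mulVr fps_unitPl fps_invr_out.

Let order f : f != 0 ->
  exists i, f i != 0 /\ forall j, (j < i)%N -> f j = 0.
Proof.
move=> f0; have /ex_minnP[i fi mini] : exists i, f i != 0.
  apply: contrapT => nex; case/eqP: f0; apply: fps_eqP => n; rewrite coeff0.
  by apply/eqP/negP => /negP fn; apply: nex; exists n.
exists i; split=> // j ltji; apply/eqP; apply: contraTT ltji => /mini.
by rewrite -leqNgt.
Qed.

Lemma fps_mulf_eq0 f g : f * g = 0 -> (f == 0) || (g == 0).
Proof.
move=> fg0; apply/negP => /negP; rewrite negb_or.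
case/andP=> /order[i [fi ltf]] /order[j [gj ltg]].
have := congr1 (fun h : fps F => h (i + j)%N) fg0.
have lti : (i < (i + j).+1)%N by rewrite ltnS leq_addr.
rewrite /= if_same (bigD1 (Ordinal lti)) //= addKn big1 ?addr0.
  by move/eqP; rewrite mulf_eq0 (negPf fi) (negPf gj).
move=> k; rewrite -val_eqE /= neq_ltn => /orP[/ltf->|ltik]; first by rewrite mul0r.
by rewrite ltg ?mulr0 // -(ltn_add2l k) subnKC ?ltn_add2r // -ltnS.
Qed.

HB.instance Definition _ :=
  GRing.ComUnitRing_isIntegral.Build (fps F) fps_mulf_eq0.

(** For [a 0 = 1] and 2 invertible, [fps_sqrt a] is the square root of [a] with
    constant term 1 ([fps_sqrt0], [fps_sqrtK], [fps_sqrt_uniq]). Comparing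
    coefficients in s ^+ 2 = a gives the recursion
    2 s_n = a_n - \sum_(0 < i < n) s_i s_(n - i); [fps_sqrt_seq a n] lists
    s_0, ..., s_(n - 1). *)
Fixpoint fps_sqrt_seq (a : fps F) (n : nat) : seq F :=
  if n is m.+1 then
    let s := fps_sqrt_seq a m in
    rcons s (if m == 0%N then 1
             else (a m - \sum_(1 <= i < m) s`_i * s`_(m - i)) / 2)
  else [::].

Definition fps_sqrt (a : fps F) : fps F := Fps (fun n => (fps_sqrt_seq a n.+1)`_n).

Let size_sqrt_seq a n : size (fps_sqrt_seq a n) = n.
Proof. by elim: n => //= n IHn; rewrite size_rcons IHn. Qed.

Let nth_sqrt_seq a n i : (i < n)%N -> (fps_sqrt_seq a n)`_i = fps_sqrt a i.
Proof.
elim: n => //= n IHn; rewrite ltnS leq_eqVlt => /orP[/eqP-> //|ltin].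
by rewrite nth_rcons size_sqrt_seq ltin IHn.
Qed.

Lemma fps_sqrt0 a : fps_sqrt a 0%N = 1.
Proof. by []. Qed.

Let sqrtS a n : (0 < n)%N -> fps_sqrt a n =
  (a n - \sum_(1 <= i < n) fps_sqrt a i * fps_sqrt a (n - i)%N) / 2.
Proof.
move=> n_gt0; rewrite {1}/fps_sqrt /= nth_rcons size_sqrt_seq ltnn eqxx.
rewrite eqn0Ngt n_gt0 /=; congr ((_ - _) / _).
apply: eq_big_nat => i /andP[i_gt0 ltin].
by rewrite !nth_sqrt_seq // ltn_subrL i_gt0.
Qed.

Let sqr_coeff f n : (0 < n)%N -> f 0%N = 1 ->
  (f ^+ 2) n = f n * 2 + \sum_(1 <= i < n) f i * f (n - i)%N.
Proof.
move=> n_gt0 f0; rewrite expr2 coeffM.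
rewrite -(big_mkord xpredT (fun i => f i * f (n - i)%N)).
rewrite big_nat_recr //= big_ltn // subn0 subnn f0 mul1r mulr1.
by rewrite addrAC mulr_natr mulr2n.
Qed.

Lemma fps_sqrtK (a : fps F) : (2 : F) != 0 -> a 0%N = 1 -> fps_sqrt a ^+ 2 = a.
Proof.
move=> nz2 a0; apply: fps_eqP => n; case: (posnP n) => [->|n_gt0].
  by rewrite expr2 coeffM big_ord1 subnn fps_sqrt0 mulr1 a0.
by rewrite sqr_coeff // sqrtS // mulfVK // subrK.
Qed.

Lemma fps_sqrt_uniq (a s : fps F) :
  (2 : F) != 0 -> s 0%N = 1 -> s ^+ 2 = a -> s = fps_sqrt a.
Proof.
move=> nz2 s0 sK.
have a0 : a 0%N = 1 by rewrite -sK expr2 coeffM big_ord1 subnn s0 mulr1.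
have /eqP := fps_sqrtK nz2 a0; rewrite -{2}sK eqf_sqr => /orP[/eqP-> //|].
move/eqP/(congr1 (fun f : fps F => f 0%N)); rewrite coeffN fps_sqrt0 s0.
by move/eqP; rewrite -subr_eq0 opprK -mulr2n (negPf nz2).
Qed.

End FormalPowerSeries.

Definition gf (tau : seq nat) : fps rat := Fps (fun n => (b n tau)%:R).

Notation "x %:F" := (@FracField.tofrac _ x) : ring_scope.

(* Main.v *)
Require Import Defs.
From mathcomp Require Import all_boot all_order all_algebra.
From mathcomp Require Import zify ring.

Set Implicit Arguments.
Unset Strict Implicit.
Unset Printing Implicit Defensive.

Import GRing.Theory.

(** An ascent sequence avoids 021 iff its positive letters weakly increase, so
    a nonempty one is extended on the right by 0, by its maximum v, or by a new
    maximum up to asc + 1. Each tau has the form q1 with q in {100, 101, 110};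
    repeating v is forbidden exactly when q, with 1 replaced by v, already
    occurs. Hence the number of extensions depends only on the slack
    s = asc - v, the part of q still to be matched, and whether the last letter
    is v.
    Let D_s count the extensions when v may not be repeated, A_s those following
    a first occurrence of v. For all three tau one gets
    (1-x) D_s = 1 + x sum_{t <= s} A_t and
    (1-x)^2 A_s = (1-x) D_s + x^2 D_{s+1}.
    This system has a unique power series solution once its boundary value is
    fixed, and comparing D_{s+1} with (1-x) D_0 D_s gives D_1 = (1-x) D_0^2,
    hence a quadratic equation for f = 1 + x D_0. *)

(** * Pattern containment through subsequences *)

Section Words.
Local Open Scope nat_scope.
Implicit Types (w s : seq nat) (a v x y : nat) (p r : bitseq).

Lemma subseq_map_nth w (idx : seq nat) :
  sorted ltn idx -> all (gtn (size w)) idx -> subseq (map (nth 0 w) idx) w.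
Proof.
move=> sidx /allP bidx; rewrite -{2}(mkseq_nth 0 w) /mkseq map_subseq //.
(* A strictly increasing list is determined by its set of elements, so [idx] is a filtered
   [iota]. *)
have -> : idx = [seq i <- iota 0 (size w) | i \in idx].
  apply: (irr_sorted_eq ltn_trans ltnn) => //.
    exact: (sorted_filter ltn_trans _ (iota_ltn_sorted _ _)).
  by move=> i; rewrite mem_filter mem_iota /= add0n; case: (boolP (i \in idx)) => // /bidx /= ->.
exact: filter_subseq.
Qed.

Lemma containsP w tau :
  reflect (exists s, [/\ subseq s w, size s = size tau &
    forall j k, j < size tau -> k < size tau ->
      ((nth 0 s j < nth 0 s k) = (nth 0 tau j < nth 0 tau k)) /\
      ((nth 0 s j == nth 0 s k) = (nth 0 tau j == nth 0 tau k))])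
  (contains w tau).
Proof.
apply: (iffP existsP) => [[f /andP[/forallP fi /forallP fo]] | [s [/subseqP[m szm ->] szs so]]].
  exists [seq nth 0 w i | i <- [seq nat_of_ord (f j) | j <- enum 'I_(size tau)]].
  have nthf j (hj : j < size tau) :
      nth 0 [seq nth 0 w i | i <- [seq nat_of_ord (f j) | j <- enum 'I_(size tau)]] j
      = nth 0 w (f (Ordinal hj)).
    rewrite (nth_map 0); last by rewrite size_map size_enum_ord.
    rewrite (nth_map (Ordinal hj)); last by rewrite size_enum_ord.
    by rewrite (_ : nth _ _ _ = Ordinal hj) //; apply: val_inj; rewrite /= nth_enum_ord.
  split.
  - apply: subseq_map_nth; last by apply/allP => _ /mapP[j _ ->] /=; exact: ltn_ord.
    rewrite sorted_map; apply: (sub_sorted (e := fun i j : 'I_(size tau) => i < j)).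
      by move=> i j lij; have /forallP/(_ j)/implyP := fi i; apply.
    have: sorted ltn (map val (enum 'I_(size tau))) by rewrite val_enum_ord iota_ltn_sorted.
    by rewrite sorted_map.
  - by rewrite 2!size_map size_enum_ord.
  - move=> j k hj hk; rewrite (nthf j hj) (nthf k hk).
    by have /forallP/(_ (Ordinal hk))/andP[/eqP-> /eqP->] := fo (Ordinal hj).
set idx := mask m (iota 0 (size w)).
have sE : mask m w = map (nth 0 w) idx by rewrite map_mask -/(mkseq _ _) mkseq_nth.
have szi : size idx = size tau by rewrite -szs sE size_map.
have bi j : j < size tau -> nth 0 idx j < size w.
  rewrite -szi => hj; have /mem_mask := mem_nth 0 hj.
  by rewrite mem_iota.
exists [ffun j : 'I_(size tau) => Ordinal (bi j (ltn_ord j))].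
apply/andP; split; apply/forallP => j; apply/forallP => k.
  rewrite !ffunE /=; apply/implyP => ljk.
  have si : sorted ltn idx by rewrite sorted_mask ?iota_ltn_sorted //; exact: ltn_trans.
  by apply: (sorted_ltn_nth ltn_trans 0 si) => //; rewrite inE szi.
rewrite !ffunE /=; have [] := so j k (ltn_ord j) (ltn_ord k).
by rewrite sE !(nth_map 0) ?szi // => -> ->; rewrite !eqxx.
Qed.

(** Realises a binary pattern [q] as the word [map (letter a y) q], with small letter [a] and large
    letter [y]. *)
Definition letter a y (c : bool) : nat := if c then y else a.

Lemma contains021P w :
  reflect (exists a x y, [/\ a < x, x < y & subseq [:: a; y; x] w])
          (contains w [:: 0; 2; 1]).
Proof.
apply: (iffP (containsP _ _)) => [[s [sw sz so]] | [a [x [y [lax lxy sw]]]]].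
  case: s sz sw so => [//|a [//|y [//|x [|//]]]] _ sw so.
  exists a, x, y; split=> //; first by have [] := so 0 2 isT isT.
  by have [] := so 2 1 isT isT.
exists [:: a; y; x]; split=> // j k.
by case: j => [|[|[|j]]] //; case: k => [|[|[|k]]] //= _ _; split; (apply/idP/idP || apply/eqP/eqP); lia.
Qed.

Lemma contains_bitsP w (q : bitseq) : true \in q -> false \in q ->
  reflect (exists a y, a < y /\ subseq (map (letter a y) q) w)
          (contains w (map nat_of_bool q)).
Proof.
move=> qT qF; apply: (iffP (containsP _ _)) => [[s [sw sz so]] | [a [y [lay sw]]]].
  rewrite size_map in sz so.
  have [hT hF] := (qT, qF); rewrite -!index_mem in hT hF.
  have nq c : nth 0 (map nat_of_bool q) (index c q) = c \/ index c q >= size q.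
    by case: (ltnP (index c q) (size q)) => h; [left; rewrite (nth_map false) // nth_index // -index_mem|right].
  have nqT : nth 0 (map nat_of_bool q) (index true q) = 1.
  by case: (nq true) => //; rewrite leqNgt hT.
  have nqF : nth 0 (map nat_of_bool q) (index false q) = 0 by case: (nq false) => //; rewrite leqNgt hF.
  (* The two letters are read off where each bit first occurs in [q]; this is why both bits must
     occur. *)
  exists (nth 0 s (index false q)), (nth 0 s (index true q)); split.
    by have [-> _] := so _ _ hF hT; rewrite nqT nqF.
  rewrite (_ : map _ _ = s) //; apply: (@eq_from_nth _ 0); rewrite size_map // => i hi.
  rewrite (nth_map false) // /letter; case E : (nth false q i).
    by apply/esym/eqP; have [_ ->] := so _ _ hi hT; rewrite nqT (nth_map false) // E.
  by apply/esym/eqP; have [_ ->] := so _ _ hi hF; rewrite nqF (nth_map false) // E.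
exists (map (letter a y) q); rewrite !size_map; split=> // j k hj hk.
rewrite !(nth_map false) //.
by case: (nth false q j); case: (nth false q k); rewrite /letter /=; lia.
Qed.

(** * Appending one letter to a word *)

Lemma subseq_rcons2 s w x y :
  subseq (rcons s y) (rcons w x) = subseq (rcons s y) w || (y == x) && subseq s w.
Proof.
rewrite -!(subseq_rev (rcons _ _)) !rev_rcons /=.
rewrite -(subseq_rev s w); case: eqP => [->|_] /=; last by rewrite orbF.
apply/esym/orb_idl => h; apply: subseq_trans h; exact: subseq_cons.
Qed.

Lemma asc_rcons w x : w != [::] -> asc (rcons w x) = asc w + (last 0 w < x).
Proof.
case/lastP: w => [//|w y] _; rewrite /asc !size_rcons /= big_ord_recr /=.
congr (_ + _).
  apply: eq_bigr => i _; have := ltn_ord i.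
  by rewrite !nth_rcons !size_rcons => h; rewrite (leqW h) ltnS h.
by rewrite last_rcons !nth_rcons !size_rcons !ltnn !ltnS leqnn !eqxx.
Qed.

Lemma ascent_seq_rcons w x : w != [::] ->
  ascent_seq (rcons w x) = ascent_seq w && (x <= asc w + 1).
Proof.
move=> w0; have szw : 0 < size w by case: w w0.
rewrite /ascent_seq nth_rcons szw -andbA; congr (_ && _).
apply/forallP/andP => [h | [/forallP h hx] i].
  split.
    apply/forallP => i; have hi : i < size (rcons w x) by rewrite size_rcons ltnS ltnW.
    have := h (Ordinal hi); rewrite /= nth_rcons ltn_ord -cats1 takel_cat //.
    exact/ltnW/ltn_ord.
  have hi : size w < size (rcons w x) by rewrite size_rcons.
  have := h (Ordinal hi); rewrite /= nth_rcons ltnn eqxx szw /=.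
  by rewrite -cats1 take_size_cat.
case: i => i /=; rewrite size_rcons ltnS leq_eqVlt => /orP[/eqP-> | hi].
  by rewrite nth_rcons ltnn eqxx -cats1 take_size_cat // hx implybT.
by have := h (Ordinal hi); rewrite /= nth_rcons hi -cats1 takel_cat // ltnW.
Qed.

Definition valid tau w :=
  [&& ascent_seq w, avoids w [:: 0; 2; 1] & avoids w tau].

Lemma contains_rcons w x tau : contains w tau -> contains (rcons w x) tau.
Proof.
case/containsP=> s [sw sz so]; apply/containsP; exists s; split=> //.
exact: subseq_trans sw (subseq_rcons _ _).
Qed.

(** From here on tau is encoded as [true :: rcons p true], so q is [true :: p], with p = 00, 01, 10
    for 1001, 1011, 1101. *)
Lemma valid1 p x : valid (map nat_of_bool (true :: rcons p true)) [:: x] = (x == 0).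
Proof.
rewrite /valid; have sz s : 1 < size s -> avoids [:: x] s.
  move=> hs; apply/negP => /containsP[t [/size_subseq /= h szt _]].
  by rewrite szt in h; have := leq_trans hs h.
rewrite !sz ?andbT //=; last by rewrite size_map size_rcons.
rewrite /ascent_seq /=; apply: andb_idr => _.
by apply/forallP => -[[|//] //].
Qed.

Lemma valid_rconsW tau w x : w != [::] -> valid tau (rcons w x) -> valid tau w.
Proof.
move=> w0; rewrite /valid ascent_seq_rcons // => /and3P[/andP[-> _] h1 h2] /=; apply/andP.
by split; [move: h1 | move: h2]; apply: contra => /contains_rcons; apply.
Qed.

Definition top w := foldr maxn 0 w.

Lemma top_rcons w x : top (rcons w x) = maxn (top w) x.
Proof. by elim: w => [|y w IH] /=; [rewrite max0n maxn0 | rewrite IH maxnA]. Qed.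

Lemma leq_top w x : x \in w -> x <= top w.
Proof.
elim: w => //= y w IH; rewrite inE leq_max => /orP[/eqP->|/IH->];
by rewrite ?leqnn ?orbT.
Qed.

Lemma mem_top w : 0 < top w -> top w \in w.
Proof.
elim: w => //= y w IH; rewrite inE -/(top w).
by case: (ltnP y (top w)) => [_ /IH->|]; rewrite ?orbT ?eqxx.
Qed.

Lemma last_leq_top w : last 0 w <= top w.
Proof. by case/lastP: w => // w y; rewrite last_rcons top_rcons leq_maxr. Qed.

Lemma subseq_0pair w v a : nth 0 w 0 = 0 -> 0 < v ->
  subseq [:: v; a] w -> subseq [:: 0; v; a] w.
Proof. by case: w => //= y w -> v0; rewrite gtn_eqF. Qed.

(** The initial 0 and an earlier [top w] turn every [x] with [0 < x < top w] into a 021. A new copy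
    of tau must end in [x], and its small letter must be 0, since a positive one would already give
    a 021 in [w]. *)
Lemma validS p w x : false \in p -> w != [::] ->
  let tau := map nat_of_bool (true :: rcons p true) in
  valid tau w ->
  valid tau (rcons w x) = (x <= asc w + 1) &&
    [|| x == 0, top w < x |
      (x == top w) && ~~ subseq (map (letter 0 (top w)) (true :: p)) w].
Proof.
move=> pF w0 tau /and3P[aw a021 atau].
have w00 : nth 0 w 0 = 0 by case/andP: aw => /eqP.
rewrite /valid ascent_seq_rcons // aw /=; congr (_ && _).
have E1 : contains (rcons w x) [:: 0; 2; 1] = (0 < x < top w).
  apply/contains021P/andP => [[a [x' [y [lax lxy]]]] | [x0 xt]].
    rewrite (subseq_rcons2 [:: a; y]) => /orP[h|/andP[/eqP<- h]].
      by case/negP: a021; apply/contains021P; exists a, x', y.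
    split; first lia; apply: leq_trans lxy _; apply: leq_top.
    by apply: (mem_subseq h); rewrite !inE eqxx orbT.
  exists 0, x, (top w); split=> //; rewrite (subseq_rcons2 [:: 0; top w]) eqxx /=.
  have: top w \in w by apply: mem_top; lia.
  case: (w) w00 (xt) => //= y w' -> xt'; rewrite inE sub1seq.
  by case: eqP => /= [|_ ->]; [lia | rewrite orbT].
have qT : true \in true :: rcons p true by rewrite inE eqxx.
have qF : false \in true :: rcons p true by rewrite inE mem_rcons inE pF orbT.
have E2 : contains (rcons w x) tau =
    (0 < x) && subseq (map (letter 0 x) (true :: p)) w.
  apply/contains_bitsP/andP => // [[a [y [lay]]] | [x0 h]].
    rewrite -rcons_cons map_rcons subseq_rcons2 -map_rcons => /orP[h|].
      by case/negP: atau; apply/contains_bitsP => //; exists a, y.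
    rewrite {1}/letter => /andP[/eqP yx]; rewrite yx in lay *.
    case: (posnP a) => [-> h|a0 h]; first by split=> //; lia.
    case/negP: a021; apply/contains021P; exists 0, a, x; split=> //.
    apply: subseq_0pair => //; first lia.
    apply: subseq_trans h; rewrite /= eqxx sub1seq.
    by apply/mapP; exists false.
  exists 0, x; split=> //; rewrite -rcons_cons map_rcons subseq_rcons2.
  by rewrite [letter _ _ true]/= eqxx h orbT.
rewrite /avoids E1 E2; case: (ltngtP x (top w)) => [ltx|gtx|->].
- by case: (posnP x) => [x0|_] /=; rewrite ?andbF ?x0.
- rewrite andbF /= orbT; apply/negP => /andP[_ h].
  (* Since q begins with its large letter, a new maximum, absent from [w], cannot complete tau. *)
  have := mem_subseq h (mem_head _ _); rewrite /letter => /leq_top; lia.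
- by rewrite andbF /=; case: (posnP (top w)).
Qed.

End Words.

(** * Counting extensions by slack and residue *)

Section Counting.
Local Open Scope nat_scope.
Implicit Types (w : seq nat) (a v x y : nat) (p r : bitseq).

(** [true] stands for the current maximum and [false] for 0; a letter that does not match leaves the
    residue unchanged. *)
Definition advance r (c : bool) : bitseq :=
  if r is d :: r' then if d == c then r' else r else [::].

(* The number of extensions by n letters of a word with slack s and residue r,
   where l tells whether its last letter is its maximum. A repeated maximum adds
   an ascent only after a 0; the new maxima leave slacks t = 0, ..., s. *)
Fixpoint ext p n s r (l : bool) : nat :=
  if n is m.+1 then
    ext p m s (advance r false) false
    + (if r is [::] then 0 else ext p m (s + ~~ l) (advance r true) true)
    + \sum_(t < s.+1) ext p m t p true
  else 1.

(** Greedy leftmost matching: the result is the suffix of [r] still unmatched after reading [w]. *)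
Definition scan a y r w := foldl
  (fun r x => if r is c :: r' then if letter a y c == x then r' else r else [::]) r w.

Lemma scan_rcons a y r w x : scan a y r (rcons w x) =
  if scan a y r w is c :: r' then if letter a y c == x then r' else c :: r' else [::].
Proof. by rewrite {1}/scan foldl_rcons -/(scan a y r w); case: (scan a y r w). Qed.

Lemma subseq_scan a y r w : subseq (map (letter a y) r) w = nilp (scan a y r w).
Proof.
elim: w r => [|x w IH] [|c r] //=; first by rewrite -IH sub0seq.
by rewrite -IH; case: eqP.
Qed.

Lemma scan_notin a y p w : y \notin w -> scan a y (true :: p) w = true :: p.
Proof.
rewrite /scan; elim: w => //= x w IH; rewrite inE negb_or => /andP[/negPf->].
exact: IH.
Qed.

(* The empty residue means that the maximum may not be repeated; this includes
   the case where only zeros have occurred. *)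
Definition residue p w :=
  if top w == 0 then [::] else scan 0 (top w) (true :: p) w.

Lemma sum_tuple_cons (T : finType) n (F : seq T -> nat) :
  \sum_(t : n.+1.-tuple T) F t = \sum_(x : T) \sum_(t : n.-tuple T) F (x :: t).
Proof.
rewrite pair_big /= (reindex (fun u : T * n.-tuple T => [tuple of u.1 :: u.2])) //=.
exists (fun t => (thead t, [tuple of behead t])) => [[x t] _|t _] /=.
  by congr (_, _); apply: val_inj.
by rewrite [RHS]tuple_eta.
Qed.

(** Reversing the order of summation indexes new maxima by the slack that they leave. *)
Lemma sum_ext M (f : nat -> nat) v h :
  v < h -> h <= M -> (forall x, v < x -> h <= x -> f x = 0) ->
  \sum_(v.+1 <= x < M) f x = \sum_(t < h - v.+1) f (h - t.+1).
Proof.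
move=> lvh lhM f0; rewrite (big_cat_nat (n := h)) //=.
have -> : \sum_(h <= x < M) f x = 0.
  by rewrite big_nat_cond big1 // => x; rewrite andbT => /andP[? _]; apply: f0; lia.
rewrite addn0 big_nat_rev /= -{1}(add0n v.+1) big_addn big_mkord.
by apply: eq_bigr => t _; congr f; lia.
Qed.

Section Extensions.
Variables (p : bitseq) (M : nat).
Hypothesis pF : false \in p.
Let tau := map nat_of_bool (true :: rcons p true).

Definition extensions n w :=
  \sum_(t : n.-tuple 'I_M) (valid tau (w ++ map val t) : nat).

Lemma extensions0 w : extensions 0 w = valid tau w.
Proof.
rewrite /extensions (big_pred1 [tuple]) ?cats0 // => t.
by rewrite [t]tuple0 /= eqxx.
Qed.

Lemma extensionsS n w : extensions n.+1 w = \sum_(0 <= x < M) extensions n (rcons w x).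
Proof.
rewrite /extensions (sum_tuple_cons _ (fun t => nat_of_bool (valid tau (w ++ map val t)))).
rewrite big_mkord; apply: eq_bigr => x _; apply: eq_bigr => t _.
by rewrite -cats1 -catA.
Qed.

Lemma valid_prefix w (s : seq nat) : w != [::] -> valid tau (w ++ s) -> valid tau w.
Proof.
move=> w0; elim/last_ind: s => [|s x IH]; first by rewrite cats0.
by rewrite -rcons_cat => /valid_rconsW h; apply/IH/h; case: (w) w0.
Qed.

Lemma extensions_invalid n w : w != [::] -> ~~ valid tau w -> extensions n w = 0.
Proof.
move=> w0 nv; apply: big1 => t _.
by case: (boolP (valid _ _)) => // /(valid_prefix w0); rewrite (negPf nv).
Qed.

(** Makes the truncated difference [asc w - top w] the true slack. A new maximum is at most
    [asc w + 1] and itself creates an ascent. *)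
Lemma top_asc w : w != [::] -> valid tau w -> top w <= asc w.
Proof.
elim/last_ind: w => [//|w x IH] _.
case: (eqVneq w [::]) => [->|w0] vw.
  by move: vw; rewrite /= valid1 => /eqP->.
have v' := valid_rconsW w0 vw; move: vw; rewrite validS // => /andP[hx _].
rewrite top_rcons asc_rcons //; have := IH w0 v'; have := last_leq_top w; lia.
Qed.

(** The next letter is 0, the maximum or a new maximum; all others are invalid. The bound on
    [size w + n] keeps every admissible letter below [M]. *)
Lemma extensionsE n w : size w + n <= M -> w != [::] -> valid tau w ->
  extensions n w = ext p n (asc w - top w) (residue p w) (last 0 w == top w).
Proof.
elim: n w => [|n IH] w szM w0 vw; first by rewrite extensions0 vw.
have tla := top_asc w0 vw.
have ascM : asc w + 1 < M by have := asc_le w; case: (w) szM w0 => //= *; lia.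
have r0 x : rcons w x != [::] by case: (w).
have vS x := @validS p w x pF w0 vw.
have sz' x : size (rcons w x) + n <= M by rewrite size_rcons; lia.
rewrite extensionsS big_ltn; last lia.
have E0 : extensions n (rcons w 0) =
    ext p n (asc w - top w) (advance (residue p w) false) false.
  rewrite IH ?vS ?asc_rcons // top_rcons ltn0 addn0 maxn0 last_rcons.
  rewrite /residue top_rcons maxn0; case: eqP => [->|/eqP t0].
    (* For an all-zero word the flags differ, but [ext] ignores the flag when the residue is
       empty. *)
    by rewrite eqxx; case: (n).
  rewrite eq_sym (negPf t0) scan_rcons; case: (scan _ _ _ w) => //= c r.
  by case: c => /=; rewrite ?(negPf t0).
(* The letter is [asc w + 1 - t]; it adds an ascent, so the new slack is [t]. *)
have En t : t < (asc w - top w).+1 ->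
    extensions n (rcons w (asc w + 2 - t.+1)) = ext p n t p true.
  move=> ht; set x := _ - _; have gx : top w < x by rewrite /x; lia.
  have hx : x <= asc w + 1 by rewrite /x; lia.
  rewrite IH ?vS ?hx ?gx ?orbT // asc_rcons // top_rcons last_rcons.
  have -> : maxn (top w) x = x by lia.
  rewrite eqxx (_ : _ < x); last by have := last_leq_top w; lia.
  congr (ext p n _ _ _); first by rewrite /x; lia.
  rewrite /residue top_rcons (_ : maxn _ _ = x); last lia.
  rewrite ifF; last lia.
  by rewrite scan_rcons scan_notin /= ?eqxx //; apply/negP => /leq_top; lia.
have Sn : \sum_((top w).+1 <= x < M) extensions n (rcons w x) =
    \sum_(t < (asc w - top w).+1) ext p n t p true.
  rewrite (@sum_ext _ _ _ (asc w + 2)); [|lia|lia|].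
    rewrite (_ : _ - _ = (asc w - top w).+1); last lia.
    by apply: eq_bigr => t _; apply: En.
  by move=> x _ hx; apply: extensions_invalid; rewrite ?vS // (_ : x <= _ = false) //; lia.
rewrite E0 /= -addnA; congr (_ + _).
case: (posnP (top w)) => [t0|tpos].
  (* Here the maximum is the letter 0, already counted; the empty residue makes the middle term of
     [ext] vanish. *)
  by rewrite {1}/residue {1}t0 eqxx add0n -Sn t0.
rewrite (big_cat_nat (n := top w)) //=; last lia.
rewrite big_nat_cond big1 ?add0n; last first.
  move=> x; rewrite andbT => /andP[x0 xt]; apply: extensions_invalid => //.
  by rewrite vS; apply/negP => /andP[_]; lia.
rewrite big_ltn; last lia.
rewrite Sn; congr (_ + _).
have rE : residue p w = scan 0 (top w) (true :: p) w by rewrite /residue ifF //; lia.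
have := vS (top w); rewrite subseq_scan -rE eqxx ltnn (_ : top w <= _); last lia.
rewrite (_ : top w == 0 = false) /=; last lia.
case Er : (residue p w) => [|c r] /= vt.
  by apply: extensions_invalid; rewrite ?vt.
rewrite IH ?vt // asc_rcons // top_rcons maxnn last_rcons eqxx.
congr (ext p n _ _ _).
  by have := last_leq_top w; rewrite leq_eqVlt => /orP[/eqP->|h]; rewrite ?eqxx ?ltnn; lia.
rewrite /residue top_rcons maxnn ifF; last lia.
rewrite scan_rcons -rE Er; case: (c) => /=; first by rewrite eqxx.
by rewrite ifF //; lia.
Qed.

End Extensions.

(** All words grow from the single letter 0, which has slack 0 and empty residue. *)
Lemma b_ext p n : false \in p ->
  b n.+1 (map nat_of_bool (true :: rcons p true)) = ext p n 0 [::] true.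
Proof.
move=> pF; set tau := map _ _.
have -> : b n.+1 tau = extensions p n.+1 n.+1 [::].
  rewrite /b /B -sum1_card big_mkcond; apply: eq_bigr => t _.
  by rewrite inE -/(valid tau _); case: (valid _ _).
rewrite extensionsS big_ltn // big_nat_cond big1 => [|x].
  rewrite addn0 extensionsE ?valid1 //=; first by rewrite /asc big_ord0.
by rewrite andbT => /andP[x0 _]; apply: extensions_invalid; rewrite //= valid1; lia.
Qed.

Lemma b0 tau : 0 < size tau -> b 0 tau = 1.
Proof.
move=> st.
have nc s : 0 < size s -> avoids [::] s.
  by move=> hs; apply/negP => /containsP[u []]; case: u => //= _ h; rewrite -h in hs.
rewrite /b /B (_ : [set _ | _] = setT) ?cardsT ?card_tuple //.
apply/setP => t; rewrite !inE [t]tuple0 /= !nc ?andbT // /ascent_seq eqxx.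
by apply/forallP => -[].
Qed.

End Counting.

(** * Generating functions and their linear system *)

Section GeneratingFunctions.
Local Open Scope ring_scope.
Local Notation x := (fpsX rat).
Implicit Types (f g : fps rat) (p r : bitseq).

Lemma coeffXM f n : (x * f) n = if n is m.+1 then f m else 0.
Proof.
rewrite coeffM; case: n => [|m]; first by rewrite big_ord1 /= mul0r.
rewrite big_ord_recl big_ord_recl /= mul0r add0r mul1r big1 ?addr0 ?subn0 ?subn1 //.
by move=> i _; rewrite mul0r.
Qed.

Lemma coeff_sum (I : finType) (F : I -> fps rat) n :
  (\sum_i F i) n = \sum_i F i n.
Proof. by apply: (big_morph (fun f : fps rat => f n)) => //; exact: coeff0. Qed.

(** Divisibility of [f] by the n-th power of [x]. *)
Definition low n f := forall k, (k < n)%N -> f k = 0.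

Lemma lowD n f g : low n f -> low n g -> low n (f + g).
Proof. by move=> hf hg k hk; rewrite coeffD hf ?hg ?addr0. Qed.

Lemma lowM n f g : low n g -> low n (f * g).
Proof.
move=> hg k hk; rewrite coeffM big1 // => i _.
by rewrite hg ?mulr0 // (leq_ltn_trans (leq_subr _ _)).
Qed.

Lemma lowXM n f : low n f -> low n.+1 (x * f).
Proof. by move=> hf [|k] hk; rewrite coeffXM // hf. Qed.

Lemma low_eq0 f : (forall n, low n f) -> f = 0.
Proof. by move=> h; apply: fps_eqP => n; rewrite coeff0 (h n.+1). Qed.

(** Modulo a multiple of [x], the recurrence says that [E s.+1] equals [E s]. So divisibility of all
    [E s] by the n-th power of [x] improves to the next power, by induction on [s] from
    [E 0 = 0]. *)
Lemma gf_system_uniq (E : nat -> fps rat) :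
  E 0%N = 0 ->
  (forall s, (1 - x) ^+ 3 * (E s.+1 - E s)
     = x * (1 - x) * E s.+1 + x ^+ 3 * E s.+2) ->
  forall s, E s = 0.
Proof.
move=> E0 Es s; apply: low_eq0 => n; elim: n s => [|n IHn] s; first by move=> k.
elim: s => [|s IHs]; first by move=> k _; rewrite E0 coeff0.
(* Uses [(1 - x) ^+ 3 = 1 - x * (3 - 3 * x + x ^+ 2)]. *)
have -> : E s.+1 = E s + x * ((3 - 3 * x + x ^+ 2) * E s.+1
    + (- (3 - 3 * x + x ^+ 2) * E s + ((1 - x) * E s.+1 + x ^+ 2 * E s.+2))).
  apply: subr0_eq; rewrite -[RHS](subrr (x * (1 - x) * E s.+1 + x ^+ 3 * E s.+2)).
  by rewrite -{1}Es; ring.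
by apply: lowD => //; apply: lowXM; do 3?[apply: lowD]; apply: lowM.
Qed.

Definition ext_gf p s r l : fps rat := Fps (fun n => (ext p n s r l)%:R).

Lemma ext_gfE p s r l : ext_gf p s r l =
  1 + x * \sum_(t < s.+1) ext_gf p t p true + x * ext_gf p s (advance r false) false
  + x * (if r is [::] then 0 else ext_gf p (s + ~~ l) (advance r true) true).
Proof.
apply: fps_eqP => n; rewrite !coeffD !coeffXM coeff1.
case: n => [|n]; first by rewrite !addr0.
rewrite /= add0r !natrD coeff_sum natr_sum /=.
rewrite addrC -!addrA; congr (_ + (_ + _)).
by case: r => [|? ?] //; rewrite coeff0.
Qed.

Lemma ext_gf_nil p s l : ext_gf p s [::] l = ext_gf p s [::] true.
Proof. by rewrite ext_gfE [RHS]ext_gfE. Qed.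

(** The second equation of the system: [ext_gf p s [::] true] is D_s, and [ext_gf p s p true] is
    A_s, because a first occurrence of v matches the leading 1 of q. *)
Definition block_gf_eq p := forall s,
  (1 - x) ^+ 2 * ext_gf p s p true
    = (1 - x) * ext_gf p s [::] true + x ^+ 2 * ext_gf p s.+1 [::] true.

(** The first equation of the system: on an empty residue, a 0 leaves the count unchanged and any
    other letter is a new maximum. *)
Lemma block_sum p s : 1 + x * \sum_(t < s.+1) ext_gf p t p true =
  (1 - x) * ext_gf p s [::] true.
Proof.
rewrite mulrBl mul1r {1}ext_gfE mulr0 addr0 /= ext_gf_nil.
by rewrite addrK.
Qed.

Lemma ext_gf_cons p s r l : r != [::] -> ext_gf p s r l =
  (1 - x) * ext_gf p s [::] true + x * ext_gf p s (advance r false) false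
  + x * ext_gf p (s + ~~ l) (advance r true) true.
Proof. by rewrite ext_gfE block_sum; case: r. Qed.

(** Repeating the maximum returns to the same state, which gives the factor [1 - x]; a 0 completes
    q. *)
Lemma ext_gf_F p s : (1 - x) * ext_gf p s [:: false] true = ext_gf p s [::] true.
Proof.
have := @ext_gf_cons p s [:: false] true isT; rewrite /= addn0 ext_gf_nil.
set c := ext_gf _ _ [:: _] _; set d := ext_gf _ _ _ _ => e.
by rewrite mulrBl mul1r {1}e; ring.
Qed.

(** Both letters 0 can be separated by maxima; a maximum repeated right after the first 0 raises the
    slack, whence D_{s+1}. *)
Lemma block_gf_eq_1001 : block_gf_eq [:: false; false].
Proof.
move=> s; set p := [:: _; _].
have := ext_gf_cons p s (r := p) true isT; rewrite /= addn0.
have := ext_gf_cons p s (r := [:: false]) false isT; rewrite /= addn1 ext_gf_nil.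
have := ext_gf_F p s.+1.
move: (ext_gf p s p true) (ext_gf p s [:: false] false) (ext_gf p s.+1 [:: false] true).
move: (ext_gf p s _ true) (ext_gf p s.+1 _ true) => d d' a b c <- -> e.
transitivity ((1 - x) * (a - x * a)); first by ring.
by rewrite {1}e; ring.
Qed.

Lemma block_gf_eq_1011 : block_gf_eq [:: false; true].
Proof.
move=> s; set p := [:: _; _].
have := ext_gf_cons p s (r := p) true isT; rewrite /= addn0.
have := ext_gf_cons p s (r := [:: true]) false isT; rewrite /= addn1.
move: (ext_gf p s p true) (ext_gf p s [:: true] false).
move: (ext_gf p s _ true) (ext_gf p s.+1 _ true) => d d' a b eb ea.
transitivity ((1 - x) * (a - x * a)); first by ring.
rewrite {1}ea; transitivity ((1 - x) ^+ 2 * d + x * (b - x * b)); first by ring.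
by rewrite {1}eb; ring.
Qed.

(** The second 1 of q may come at once, keeping the slack, or after some zeros, raising it by one.
    Both routes end in the state solved by [ext_gf_F]. *)
Lemma block_gf_eq_1101 : block_gf_eq [:: true; false].
Proof.
move=> s; set p := [:: _; _].
have := ext_gf_cons p s (r := p) true isT; rewrite /= addn0.
have := ext_gf_cons p s (r := p) false isT; rewrite /= addn1.
have := ext_gf_F p s.+1; have := ext_gf_F p s.
move: (ext_gf p s p true) (ext_gf p s p false) (ext_gf p s.+1 [:: false] true)
 (ext_gf p s [:: false] true).
move: (ext_gf p s _ true) (ext_gf p s.+1 _ true) => d d' a b c' c <- <- eb ->.
transitivity ((1 - x) ^+ 4 * c + x * (1 - x) * (b - x * b) + x * (1 - x) ^+ 2 * c); first by ring.
by rewrite {1}eb; ring.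
Qed.

Lemma fps_1X_neq0 : 1 - x != 0.
Proof.
apply/eqP => /(congr1 (fun f : fps rat => f 0%N)).
by rewrite coeffD coeffN coeff1 coeff0 /= subr0 => /eqP; rewrite oner_eq0.
Qed.

(** * From the linear system to a quadratic equation *)

Section Quadratic.
Variable p : bitseq.
Hypothesis block : block_gf_eq p.
Let D s := ext_gf p s [::] true.

Lemma ext_gf0 : (1 - x) ^+ 2 * D 0%N - (1 - x) = x * D 0%N + x ^+ 3 * D 0%N ^+ 2.
Proof.
(* This is the recurrence [eS] at s = -1, with 1 / (1 - x) in place of D_{-1}. *)
have e0 : (1 - x) ^+ 3 * D 0%N - (1 - x) ^+ 2 = x * (1 - x) * D 0%N + x ^+ 3 * D 1%N.
  have := block_sum p 0; rewrite big_ord1 -/(D 0%N) => h.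
  transitivity ((1 - x) ^+ 2 * ((1 - x) * D 0%N - 1)); first by ring.
  by rewrite -h addrAC subrr add0r mulrCA block -/(D 0%N) -/(D 1%N); ring.
(* Subtracting consecutive first equations isolates A_{s+1}, which the second equation
   eliminates. *)
have eS s : (1 - x) ^+ 3 * (D s.+1 - D s) = x * (1 - x) * D s.+1 + x ^+ 3 * D s.+2.
  transitivity ((1 - x) ^+ 2 * ((1 - x) * D s.+1 - (1 - x) * D s)); first by ring.
  rewrite -!block_sum big_ord_recr /=.
  transitivity (x * ((1 - x) ^+ 2 * ext_gf p s.+1 p true)); first by ring.
  by rewrite block -/(D _) -/(D _); ring.
have D1 : D 1%N = (1 - x) * D 0%N ^+ 2.
  (* Both [s |-> D s] and [s |-> (1 - x) * D 0 * D (s - 1)] solve the same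
     recurrence; for the second, [D (-1)] stands for [1 / (1 - x)]. *)
  pose E s := D s - if s is s'.+1 then (1 - x) * D 0%N * D s' else D 0%N.
  have E1 : E 1%N = 0.
    apply: gf_system_uniq => [|[|s]]; rewrite /E ?subrr //.
      transitivity ((1 - x) ^+ 3 * (D 1%N - D 0%N)
        - (1 - x) * D 0%N * ((1 - x) ^+ 3 * D 0%N - (1 - x) ^+ 2)); first by ring.
      by rewrite eS e0; ring.
    transitivity ((1 - x) ^+ 3 * (D s.+2 - D s.+1)
        - (1 - x) * D 0%N * ((1 - x) ^+ 3 * (D s.+1 - D s))); first by ring.
    by rewrite !eS; ring.
  by apply: subr0_eq; rewrite -[RHS]E1 /E; ring.
(* Inserting [D1] in [e0] gives the claim multiplied by [1 - x]. *)
apply: (mulfI fps_1X_neq0).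
transitivity ((1 - x) ^+ 3 * D 0%N - (1 - x) ^+ 2); first by ring.
by rewrite e0 D1; ring.
Qed.

End Quadratic.

Lemma gf_quadratic p : false \in p -> block_gf_eq p ->
  let f := gf (map nat_of_bool (true :: rcons p true)) in
  x ^+ 2 * f ^+ 2 - (1 - 3 * x + 3 * x ^+ 2) * f + (1 - x) ^+ 2 = 0.
Proof.
move=> pF block f.
have -> : f = 1 + x * ext_gf p 0 [::] true.
  apply: fps_eqP => -[|n]; rewrite coeffD coeff1 coeffXM /=.
    by rewrite b0 ?addr0 // size_map.
  by rewrite b_ext // add0r.
have := ext_gf0 block; move: (ext_gf _ _ _ _) => d /eqP; rewrite -subr_eq0 => /eqP e.
by rewrite -[RHS](mulr0 (- x)) -e; ring.
Qed.

End GeneratingFunctions.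

(** * Solving the quadratic equation *)

Local Open Scope ring_scope.

(* The quotient is taken in the fraction field of the power series ring. *)
Theorem theorem2p7 (tau : seq nat)
    (htau : tau \in [:: [:: 1; 0; 0; 1]; [:: 1; 0; 1; 1]; [:: 1; 1; 0; 1]]%N) :
  let x := fpsX rat in
  (gf tau)%:F =
    (1 - 3 * x + 3 * x ^+ 2
     - fps_sqrt ((1 - 3 * x + x ^+ 2) ^+ 2 - 4 * x ^+ 3 * (1 - x)))%:F
    / (2 * x ^+ 2)%:F :> {fraction (fps rat)}.
Proof.
move=> x.
have quad : x ^+ 2 * gf tau ^+ 2 - (1 - 3 * x + 3 * x ^+ 2) * gf tau + (1 - x) ^+ 2 = 0.
  move: htau; rewrite !inE => /or3P[] /eqP->.
  - exact: (gf_quadratic _ block_gf_eq_1001).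
  - exact: (gf_quadratic _ block_gf_eq_1011).
  - exact: (gf_quadratic _ block_gf_eq_1101).
set disc := _ - 4 * _ * _.
(* Completing the square in [quad]; the constant term 1 selects the branch of the root. *)
have sqrtE : 1 - 3 * x + 3 * x ^+ 2 - 2 * x ^+ 2 * gf tau = fps_sqrt disc.
  apply: fps_sqrt_uniq => //.
    rewrite (_ : _ - _ = 1 + x * (- 3 + 3 * x - 2 * x * gf tau)); last by ring.
    by rewrite coeffD coeff1 coeffXM addr0.
  transitivity (disc + 4 * x ^+ 2 * (x ^+ 2 * gf tau ^+ 2
    - (1 - 3 * x + 3 * x ^+ 2) * gf tau + (1 - x) ^+ 2)); first by rewrite /disc; ring.
  by rewrite quad mulr0 addr0.
have x2 : 2 * x ^+ 2 != 0.
  apply/eqP => /(congr1 (fun f : fps rat => f 2%N)).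
  rewrite mulrC mulr_natr mulr2n coeffD coeff0 expr2 coeffXM /=.
  by move/eqP.
have fx2 : (2 * x ^+ 2)%:F != 0 by rewrite tofrac_eq0.
by rewrite -sqrtE subKr [2 * _ * gf _]mulrC tofracM mulfK.
Qed.
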